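(* Consider a deep network $f_H(x;\theta)=\sigma_H^{W_H}\circ\cdots\circ\sigma_1^{W_1}(x)$, $x\in\mathcal D$, $\theta=(W_1,\dots,W_H)\in\Theta$, with $\rho_i$-Lipschitz continuous activation functions $\sigma_i:\mathbb R\to\mathbb R$ satisfying $\sigma_i(0)=0$, $1\le i\le H$. Suppose that $\mathcal D\times\Theta$ is bounded or $\sigma_H$ is bounded. Let $\theta=(W_1,\dots,W_H)$ and $\tilde\theta=(\tilde W_1,\dots,\tilde W_H)$. Then $$\|f_j(x;\theta(\tilde W_k))-f_j(x;\theta(\tilde W_{k-1}))\|_2\le L_{jk}\,\|x\|_2\,\|\tilde W_k-W_k\|_{op}$$ for $1\le k\le H$ (and $1\le j\le H$), where $L_{jk}=\Big(\prod_{i=1,\,i\ne k}^j\rho_i\|W_i\|_{op}\Big)\rho_k$. Moreover, the neural network has the Lipschitz property $$\|f_H(x;\theta)-f_H(x;\tilde\theta)\|_2\le L_H\sqrt H\,\|x\|_2\,\|\tilde\theta-\theta\|_F,$$ where $L_H=\max_{1\le k\le H}L_{Hk}$.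
   Context: $\mathcal D\subset\mathbb R^{n_0}$ is the set of inputs, $W_j\in\mathbb R^{n_j\times n_{j-1}}$ are weight matrices, $\Theta$ is the parameter set of tuples of weight matrices. Activation functions act entrywise on vectors, $\sigma_j^{W_j}(x)=\sigma_j(W_jx)$ for $x\in\mathbb R^{n_{j-1}}$, and $f_j(x;\theta)=\sigma_j^{W_j}\circ\cdots\circ\sigma_1^{W_1}(x)$ is the output of the $j$th hidden layer. For $1\le k\le H$, $\theta(\tilde W_k)=(\tilde W_1,\dots,\tilde W_k,W_{k+1},\dots,W_H)$, and $\theta(\tilde W_0)=(W_1,\dots,W_H)$. $\|\cdot\|_{op}$ is the spectral norm and $\|\tilde\theta-\theta\|_F=\big(\sum_{k=1}^H\|\tilde W_k-W_k\|_F^2\big)^{1/2}$ with $\|\cdot\|_F$ the Frobenius norm.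
   Formalization: As printed the bounds fail (H=2, widths 1, σ=id, W=(0,0), W̃=(1,1), x=1); the formal version takes the norms in L_jk at θ(W̃_k), i.e. ‖W̃_i‖ for i<k and ‖W_i‖ for i>k, and L_H is the maximum over k of these corrected L_Hk. *)

(* Defs.v *)
From HB Require Import structures.
From mathcomp Require Import all_boot all_order all_algebra.
From mathcomp Require Import boolp classical_sets reals topology normedtype.

Set Implicit Arguments.
Unset Strict Implicit.
Unset Printing Implicit Defensive.

Import Order.TTheory GRing.Theory Num.Theory.
Import numFieldNormedType.Exports.

Local Open Scope classical_set_scope.
Local Open Scope ring_scope.

(* The library norm on matrices is the sup norm, hence the
   explicit Euclidean, Frobenius and spectral norms below. *)

Definition norm2 (R : realType) (m : nat) (x : 'cV[R]_m) : R :=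
  Num.sqrt (\sum_(i < m) x i 0 ^+ 2).

Definition frobenius (R : realType) (m p : nat) (A : 'M[R]_(m, p)) : R :=
  Num.sqrt (\sum_(i < m) \sum_(j < p) A i j ^+ 2).

(* The set is nonempty and bounded above by [frobenius A], so this [sup] is a
   genuine supremum, also when m = 0 or p = 0. *)
Definition opnorm (R : realType) (m p : nat) (A : 'M[R]_(m, p)) : R :=
  sup [set norm2 (A *m x) | x in [set x : 'cV[R]_p | norm2 x <= 1]].

(* Layers are indexed from 0: [W i], [sigma i], [rho i] with i : 'I_H stand for
   W_{i+1}, sigma_{i+1}, rho_{i+1}; the layer widths n_0, ..., n_H are not
   shifted. *)
Definition weights (R : realType) (n : nat -> nat) (H : nat) : Type :=
  forall i : 'I_H, 'M[R]_(n i.+1, n i).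

Definition weights_dist (R : realType) (n : nat -> nat) (H : nat)
    (W V : weights R n H) : R :=
  Num.sqrt (\sum_(k < H) frobenius (W k - V k) ^+ 2).

(* [layer sigma W hj x] is f_j(x; W), the output of the first j layers. *)
Fixpoint layer (R : realType) (n : nat -> nat) (H : nat)
    (sigma : 'I_H -> R -> R) (W : weights R n H) (j : nat) :
    (j <= H)%N -> 'cV[R]_(n 0%N) -> 'cV[R]_(n j) :=
  match j with
  | 0%N => fun _ x => x
  | i.+1 => fun (hi : (i < H)%N) x =>
      map_mx (sigma (Ordinal hi))
        (W (Ordinal hi) *m layer sigma W (ltnW hi) x)
  end.

(* theta(V_m) = (V_1, ..., V_m, W_{m+1}, ..., W_H) for theta = W. *)
Definition hybrid (R : realType) (n : nat -> nat) (H : nat)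
    (W V : weights R n H) (m : nat) : weights R n H :=
  fun i => if (i < m)%N then V i else W i.

(* L_{j,k+1} at the weights W, where j counts layers and k is 0-based. *)
Definition Lconst (R : realType) (n : nat -> nat) (H : nat)
    (rho : 'I_H -> R) (W : weights R n H) (j : nat) (k : 'I_H) : R :=
  (\prod_(i < H | (i < j)%N && (i != k)) (rho i * opnorm (W i))) * rho k.

(* L_H.  The k-th constant is taken at the weights theta(V_k).  These agree
   with theta(V_{k-1}) off layer k, and [Lconst] does not read layer k, so its
   factors are the weights shared by the two networks that differ in layer k.
   With the weights W throughout, the Lipschitz bound fails: take H = 2, all
   widths 1, sigma = id, W = (0, 0), V = (1, 1).  All constants are
   nonnegative, so 0 is a neutral starting value for the maximum. *)
Definition Lmax (R : realType) (n : nat -> nat) (H : nat)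
    (rho : 'I_H -> R) (W V : weights R n H) : R :=
  \big[Num.max/0]_(k < H) Lconst rho (hybrid W V k.+1) H k.

(* Main.v *)
Require Import Defs.
From HB Require Import structures.
From mathcomp Require Import all_boot all_order all_algebra.
From mathcomp Require Import boolp classical_sets reals topology normedtype.
From mathcomp Require Import ring.

Set Implicit Arguments.
Unset Strict Implicit.
Unset Printing Implicit Defensive.

Import Order.TTheory GRing.Theory Num.Theory.
Import numFieldNormedType.Exports.

Local Open Scope classical_set_scope.
Local Open Scope ring_scope.

(** Replace the weight matrices of one network by those of the other, one layer
    at a time.  Two consecutive networks of this chain differ in a single
    layer [k]; write [A] for the weights of the layers they share.  They feed
    the same vector into layer [k], and since every activation fixes 0 and is
    Lipschitz, the norm of that vector is at most [norm2 x] times the product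
    of the [rho i * opnorm (A i)] over the earlier layers ([norm2_layer]).
    Layer [k] turns it into two outputs at distance at most
    [rho k * opnorm (V k - W k)] times that norm, and each later layer, being
    common to both networks, expands distances by at most its own
    [rho i * opnorm (A i)].  Multiplying up gives the single-layer estimate
    ([norm2_layer_perturb]).

    For the distance between the two full networks, telescope along the chain
    and apply the triangle inequality.  Bounding each constant by the maximum
    leaves the sum over [k] of [opnorm (V k - W k)]; the spectral norm is at
    most the Frobenius norm, and Cauchy-Schwarz against the vector with all
    entries 1 turns the sum of [H] Frobenius norms into the square root of [H]
    times the Euclidean one ([sum_opnorm_le_weights_dist]).

    The triangle inequality and the bound on a matrix product by the Frobenius
    norm also come from Cauchy-Schwarz for finite sums; the latter makes the
    supremum defining [opnorm] finite. *)

(** * Euclidean, Frobenius and spectral norms *)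

(** Lagrange's identity: the product of the sums of squares exceeds the square
    of the sum of products by half a sum of squares. *)
Lemma cauchy_schwarz_sum (R : realType) (I : finType) (a b : I -> R) :
  \sum_i a i * b i
  <= Num.sqrt (\sum_i a i ^+ 2) * Num.sqrt (\sum_i b i ^+ 2).
Proof.
set A := \sum_i a i ^+ 2; set B := \sum_i b i ^+ 2; set C := \sum_i a i * b i.
have A0 : 0 <= A by apply: sumr_ge0 => i _; exact: sqr_ge0.
have sqE : \sum_i \sum_j (a i * b j - a j * b i) ^+ 2 = (A * B - C ^+ 2) *+ 2.
  have -> : \sum_i \sum_j (a i * b j - a j * b i) ^+ 2
      = \sum_i \sum_j (a i ^+ 2 * b j ^+ 2)
        + \sum_i \sum_j (b i ^+ 2 * a j ^+ 2)
        - (\sum_i \sum_j (a i * b i) * (a j * b j)) *+ 2.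
    rewrite -sumrMnl -big_split -sumrB; apply: eq_bigr => i _.
    rewrite -sumrMnl -big_split -sumrB; apply: eq_bigr => j _ /=.
    by ring.
  by rewrite -!big_distrlr/= -/A -/B -/C; ring.
rewrite -sqrtrM//; apply: (le_trans (ler_norm _)).
rewrite -sqrtr_sqr ler_wsqrtr// -subr_ge0 -(pmulrn_lge0 _ (ltn0Sn 1)) -sqE.
by apply: sumr_ge0 => i _; apply: sumr_ge0 => j _; exact: sqr_ge0.
Qed.

Lemma norm2_ge0 (R : realType) m (x : 'cV[R]_m) : 0 <= norm2 x.
Proof. exact: sqrtr_ge0. Qed.

Lemma sqr_norm2 (R : realType) m (x : 'cV[R]_m) :
  norm2 x ^+ 2 = \sum_i x i 0 ^+ 2.
Proof. by rewrite sqr_sqrtr//; apply: sumr_ge0 => i _; exact: sqr_ge0. Qed.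

Lemma norm2Z (R : realType) m (c : R) (x : 'cV[R]_m) :
  norm2 (c *: x) = `|c| * norm2 x.
Proof.
rewrite -sqrtr_sqr /norm2 -sqrtrM ?sqr_ge0// mulr_sumr; congr Num.sqrt.
by apply: eq_bigr => i _; rewrite mxE exprMn.
Qed.

Lemma norm2_0 (R : realType) m : norm2 (0 : 'cV[R]_m) = 0.
Proof. by rewrite -(scale0r (0 : 'cV[R]_m)) norm2Z normr0 mul0r. Qed.

Lemma norm2B_sym (R : realType) m (x y : 'cV[R]_m) :
  norm2 (x - y) = norm2 (y - x).
Proof. by rewrite -opprB -scaleN1r norm2Z normrN1 mul1r. Qed.

Lemma norm2D_le (R : realType) m (x y : 'cV[R]_m) :
  norm2 (x + y) <= norm2 x + norm2 y.
Proof.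
rewrite -ler_sqr ?nnegrE ?addr_ge0 ?norm2_ge0// sqrrD !sqr_norm2.
have -> : \sum_i (x + y) i 0 ^+ 2
    = \sum_i x i 0 ^+ 2 + (\sum_i x i 0 * y i 0) *+ 2 + \sum_i y i 0 ^+ 2.
  rewrite -sumrMnl -!big_split/=; apply: eq_bigr => i _.
  by rewrite mxE sqrrD.
by rewrite lerD2r lerD2l lerMn2r cauchy_schwarz_sum.
Qed.

Lemma norm2_sum_le (R : realType) m (I : finType) (F : I -> 'cV[R]_m) :
  norm2 (\sum_i F i) <= \sum_i norm2 (F i).
Proof.
apply: (big_ind2 (fun x r => norm2 x <= r)) => [|x r y s xr ys|//].
  by rewrite norm2_0.
by apply: (le_trans (norm2D_le _ _)); exact: lerD.
Qed.

Lemma norm2_le (R : realType) m (c : R) (x y : 'cV[R]_m) : 0 <= c ->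
  (forall i, `|x i 0| <= c * `|y i 0|) -> norm2 x <= c * norm2 y.
Proof.
move=> c0 xy; rewrite -(ger0_norm c0) -norm2Z ler_wsqrtr//.
apply: ler_sum => i _; rewrite mxE.
rewrite -(real_normK (num_real (x i 0))) -(real_normK (num_real (c * _))).
by rewrite ler_sqr ?nnegrE// normrM (ger0_norm c0).
Qed.

(** Each entry of [A *m x] is the product of a row with [x], so this is
    Cauchy-Schwarz row by row.  It is what bounds the set defining [opnorm]. *)
Lemma norm2_mulmx_frobenius (R : realType) m p (A : 'M[R]_(m, p))
    (x : 'cV[R]_p) : norm2 (A *m x) <= frobenius A * norm2 x.
Proof.
have A0 : 0 <= \sum_i \sum_j A i j ^+ 2.
  by apply: sumr_ge0 => i _; apply: sumr_ge0 => j _; exact: sqr_ge0.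
rewrite /frobenius -sqrtrM// ler_wsqrtr// mulr_suml; apply: ler_sum => i _.
have rA0 : 0 <= \sum_j A i j ^+ 2 by apply: sumr_ge0 => j _; exact: sqr_ge0.
rewrite mxE -sqr_norm2 -[X in X * _]sqr_sqrtr// -exprMn -real_normK ?num_real//.
rewrite ler_sqr ?nnegrE ?mulr_ge0 ?sqrtr_ge0// ler_norml lerNl.
(* Cauchy-Schwarz bounds the sum from above; for the bound from below it is
   applied to the opposite row. *)
rewrite (cauchy_schwarz_sum (A i) (fun j => x j 0)) andbT -sumrN.
under eq_bigr do rewrite -mulNr.
apply: (le_trans (cauchy_schwarz_sum _ _)).
by under eq_bigr do rewrite sqrrN.
Qed.

Lemma ubound_frobenius (R : realType) m p (A : 'M[R]_(m, p)) :
  ubound [set norm2 (A *m x) | x in [set x : 'cV[R]_p | norm2 x <= 1]]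
         (frobenius A).
Proof.
move=> _ [x /= x1 <-]; apply: (le_trans (norm2_mulmx_frobenius _ _)).
by rewrite ler_piMr ?sqrtr_ge0.
Qed.

Lemma norm2_mulmx_unit_ball (R : realType) m p (A : 'M[R]_(m, p))
    (x : 'cV[R]_p) : norm2 x <= 1 -> norm2 (A *m x) <= opnorm A.
Proof.
move=> x1; apply: ub_le_sup; last by exists x.
by exists (frobenius A); exact: ubound_frobenius.
Qed.

Lemma opnorm_ge0 (R : realType) m p (A : 'M[R]_(m, p)) : 0 <= opnorm A.
Proof.
have := @norm2_mulmx_unit_ball _ _ _ A 0.
by rewrite mulmx0 !norm2_0; apply.
Qed.

Lemma opnorm_le_frobenius (R : realType) m p (A : 'M[R]_(m, p)) :
  opnorm A <= frobenius A.
Proof.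
apply: ge_sup; last exact: ubound_frobenius.
by exists (norm2 (A *m 0)), 0 => //=; rewrite norm2_0.
Qed.

(** By homogeneity it is enough to look at unit vectors, where this is the
    definition of [opnorm].  Normalizing fails for [norm2 x = 0]; there the
    Frobenius bound already forces the left-hand side to vanish. *)
Lemma norm2_mulmx (R : realType) m p (A : 'M[R]_(m, p)) (x : 'cV[R]_p) :
  norm2 (A *m x) <= opnorm A * norm2 x.
Proof.
have [x0|x_neq0] := eqVneq (norm2 x) 0.
  by apply: (le_trans (norm2_mulmx_frobenius _ _)); rewrite x0 !mulr0.
have x_gt0 : 0 < norm2 x by rewrite lt_neqAle eq_sym x_neq0 norm2_ge0.
rewrite -ler_pdivrMr// mulrC.
have norm2_xV : `|(norm2 x)^-1| = (norm2 x)^-1.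
  by rewrite ger0_norm// invr_ge0 norm2_ge0.
rewrite -norm2_xV -norm2Z scalemxAr norm2_mulmx_unit_ball//.
by rewrite norm2Z norm2_xV mulVf.
Qed.

(** * Entrywise Lipschitz maps *)

Lemma lipschitz_dist (R : realType) (r : R) (f : R -> R) :
  r.-lipschitz f -> forall a b, `|f a - f b| <= r * `|a - b|.
Proof. by move=> fr a b; exact: (fr (a, b)). Qed.

Lemma lipschitz_const_ge0 (R : realType) (r : R) (f : R -> R) :
  r.-lipschitz f -> 0 <= r.
Proof.
move/lipschitz_dist/(_ 1 0); rewrite subr0 normr1 mulr1.
exact: le_trans.
Qed.

Lemma norm2_map_mx_lipschitz (R : realType) m (r : R) (f : R -> R)
    (x y : 'cV[R]_m) : r.-lipschitz f ->
  norm2 (map_mx f x - map_mx f y) <= r * norm2 (x - y).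
Proof.
move=> fr; apply: norm2_le => [|i]; first exact: lipschitz_const_ge0 fr.
by rewrite !mxE lipschitz_dist.
Qed.

Lemma norm2_map_mx_le (R : realType) m (r : R) (f : R -> R) (x : 'cV[R]_m) :
  r.-lipschitz f -> f 0 = 0 -> norm2 (map_mx f x) <= r * norm2 x.
Proof.
move=> fr f0; have := norm2_map_mx_lipschitz x 0 fr.
rewrite subr0; congr (norm2 _ <= _).
by apply/matrixP => i j; rewrite !mxE f0 subr0.
Qed.

(** * Perturbation of a single layer *)

Lemma layer_eq (R : realType) (n : nat -> nat) H (sigma : 'I_H -> R -> R)
    (A B : weights R n H) j (hj : (j <= H)%N) x :
  (forall i : 'I_H, (i < j)%N -> A i = B i) ->
  layer sigma A hj x = layer sigma B hj x.
Proof.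
elim: j hj => [//|j IH] hj AB /=; rewrite AB ?ltnSn// IH// => i ij.
by rewrite AB// ltnW.
Qed.

(** Peels the last factor off a product over the first [j.+1] layers, and
    identifies the product in [Lconst] at its own layer with the one over the
    earlier layers. *)
Lemma ltnS_neq_Ordinal H j (hj : (j < H)%N) (i : 'I_H) :
  (i < j.+1)%N && (i != Ordinal hj) = (i < j)%N.
Proof. by rewrite ltnS andbC ltn_neqAle. Qed.

Lemma norm2_layer (R : realType) (n : nat -> nat) H (sigma : 'I_H -> R -> R)
    (rho : 'I_H -> R) (A : weights R n H) x :
  (forall i, (rho i).-lipschitz (sigma i)) -> (forall i, sigma i 0 = 0) ->
  forall j (hj : (j <= H)%N),
  norm2 (layer sigma A hj x)
  <= (\prod_(i < H | (i < j)%N) (rho i * opnorm (A i))) * norm2 x.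
Proof.
move=> lip sigma0; elim=> [|j IH] hj /=; first by rewrite big_pred0// mul1r.
have rho0 := lipschitz_const_ge0 (lip (Ordinal hj)).
apply: (le_trans (norm2_map_mx_le _ (lip _) (sigma0 _))).
rewrite (bigD1 (Ordinal hj)) ?ltnSn//= -!mulrA ler_wpM2l//.
apply: (le_trans (norm2_mulmx _ _)); rewrite ler_wpM2l ?opnorm_ge0//.
by rewrite (eq_bigl _ _ (ltnS_neq_Ordinal hj)).
Qed.

Lemma Lconst_ge0 (R : realType) (n : nat -> nat) H (rho : 'I_H -> R)
    (A : weights R n H) j k : (forall i, 0 <= rho i) -> 0 <= Lconst rho A j k.
Proof.
move=> rho0; rewrite mulr_ge0// prodr_ge0// => i _.
by rewrite mulr_ge0// opnorm_ge0.
Qed.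

(** Up to layer [k] the two networks coincide, so there is no error to
    propagate and only the size of the common input of layer [k] matters;
    layer [k] turns it into an error proportional to [A k - B k]; the later
    layers, which are again common, multiply that error by their Lipschitz
    constants. *)
Lemma norm2_layer_perturb (R : realType) (n : nat -> nat) H
    (sigma : 'I_H -> R -> R) (rho : 'I_H -> R) (A B : weights R n H)
    (k : 'I_H) x :
  (forall i, (rho i).-lipschitz (sigma i)) -> (forall i, sigma i 0 = 0) ->
  (forall i, i != k -> A i = B i) ->
  forall j (hj : (j <= H)%N),
  norm2 (layer sigma A hj x - layer sigma B hj x)
  <= Lconst rho A j k * norm2 x * opnorm (A k - B k).
Proof.
move=> lip sigma0 AB.
have rho0 i : 0 <= rho i := lipschitz_const_ge0 (lip i).
have bound_ge0 j : 0 <= Lconst rho A j k * norm2 x * opnorm (A k - B k).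
  by rewrite mulr_ge0 ?opnorm_ge0// mulr_ge0 ?norm2_ge0 ?Lconst_ge0.
elim=> [|j IH] hj; first by rewrite subrr norm2_0.
have [jk|kj] := ltnP j k.
  rewrite (layer_eq (B := B) sigma) => [|i ij].
    by rewrite subrr norm2_0.
  apply: AB; apply: contraTneq ij => ->.
  by rewrite ltnS -ltnNge.
rewrite /=; apply: (le_trans (norm2_map_mx_lipschitz _ _ (lip _))).
have [jkE|j_neqk] := eqVneq (Ordinal hj) k.
  subst k.
  (* The input of layer [k] only reads the layers before it. *)
  rewrite (layer_eq (A := B) (B := A) sigma) => [|i ij]; last first.
    by rewrite AB//; apply: contraTneq ij => ->; rewrite ltnn.
  rewrite -mulmxBl /Lconst [_ * rho _]mulrC -!mulrA ler_wpM2l//.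
  apply: (le_trans (norm2_mulmx _ _)).
  rewrite mulrA mulrC ler_wpM2r ?opnorm_ge0//.
  rewrite (eq_bigl _ _ (ltnS_neq_Ordinal hj)).
  exact: norm2_layer.
rewrite -AB// -mulmxBr.
have -> : Lconst rho A j.+1 k = rho (Ordinal hj) * (opnorm (A (Ordinal hj))
    * Lconst rho A j k).
  rewrite /Lconst (bigD1 (Ordinal hj)) ?ltnSn//= !mulrA; congr (_ * _ * _).
  by apply: eq_bigl => i; rewrite andbAC ltnS_neq_Ordinal.
rewrite -!mulrA ler_wpM2l//; apply: (le_trans (norm2_mulmx _ _)).
by rewrite ler_wpM2l ?opnorm_ge0//; move: (IH (ltnW hj)); rewrite -!mulrA.
Qed.

(** * Exchanging the layers one at a time *)

(** [hybrid W V k.+1] and [hybrid W V k] differ in layer [k] alone, so the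
    Lipschitz constant may be read at either of them. *)
Lemma hybrid_eq (R : realType) (n : nat -> nat) H (W V : weights R n H)
    (k i : 'I_H) : i != k -> hybrid W V k.+1 i = hybrid W V k i.
Proof. by move=> ik; rewrite /hybrid ltnS leq_eqVlt val_eqE (negPf ik). Qed.

Lemma hybrid_perturb (R : realType) (n : nat -> nat) H
    (sigma : 'I_H -> R -> R) (rho : 'I_H -> R) (W V : weights R n H)
    (k : 'I_H) j (hj : (j <= H)%N) x :
  (forall i, (rho i).-lipschitz (sigma i)) -> (forall i, sigma i 0 = 0) ->
  norm2 (layer sigma (hybrid W V k.+1) hj x - layer sigma (hybrid W V k) hj x)
  <= Lconst rho (hybrid W V k.+1) j k * norm2 x * opnorm (V k - W k).
Proof.
move=> lip sigma0.
have := norm2_layer_perturb x lip sigma0 (@hybrid_eq _ _ _ W V k) hj.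
by rewrite {4 5}/hybrid ltnSn ltnn.
Qed.

(** Cauchy-Schwarz with all coefficients 1 compares the l1 and l2 norms of the
    vector of layerwise Frobenius distances; this is the origin of the factor
    [Num.sqrt H%:R]. *)
Lemma sum_opnorm_le_weights_dist (R : realType) (n : nat -> nat) H
    (W V : weights R n H) :
  \sum_(k < H) opnorm (V k - W k) <= Num.sqrt H%:R * weights_dist V W.
Proof.
apply: (@le_trans _ _ (\sum_(k < H) 1 * frobenius (V k - W k))).
  by apply: ler_sum => k _; rewrite mul1r opnorm_le_frobenius.
apply: (le_trans (cauchy_schwarz_sum _ _)).
by under eq_bigr do rewrite expr1n; rewrite sumr_const card_ord.
Qed.

Theorem proposition2 (R : realType) (H : nat) (n : nat -> nat)
    (D : set 'cV[R]_(n 0%N)) (Theta : set (weights R n H))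
    (sigma : 'I_H -> R -> R) (rho : 'I_H -> R) :
  (0 < H)%N ->
  (forall i : 'I_H, (rho i).-lipschitz (sigma i)) ->
  (forall i : 'I_H, sigma i 0 = 0) ->
  (exists M : R, forall (x : 'cV[R]_(n 0%N)) (W : weights R n H),
      D x -> Theta W ->
      norm2 x <= M /\ forall i : 'I_H, frobenius (W i) <= M)
  \/ (forall i : 'I_H, i.+1 = H :> nat -> bounded_fun (sigma i)) ->
  forall (x : 'cV[R]_(n 0%N)) (W V : weights R n H),
  D x -> Theta W -> Theta V ->
  (forall (k : 'I_H) (j : nat) (hj : (j <= H)%N), (0 < j)%N ->
     norm2 (layer sigma (hybrid W V k.+1) hj x
            - layer sigma (hybrid W V k) hj x)
     <= Lconst rho (hybrid W V k.+1) j k * norm2 x * opnorm (V k - W k))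
  /\
  norm2 (layer sigma W (leqnn H) x - layer sigma V (leqnn H) x)
  <= Lmax rho W V * Num.sqrt H%:R * norm2 x * weights_dist V W.
Proof.
move=> _ lip sigma0 _ x W V _ _ _; split=> [k j hj _|].
  exact: hybrid_perturb.
pose f m := layer sigma (hybrid W V m) (leqnn H) x.
have -> : layer sigma W (leqnn H) x = f 0%N by exact: layer_eq.
have -> : layer sigma V (leqnn H) x = f H.
  by apply: layer_eq => i iH; rewrite /hybrid iH.
rewrite norm2B_sym -telescope_sumr// big_mkord.
apply: (le_trans (norm2_sum_le _)).
apply: (@le_trans _ _
    (\sum_(k < H) Lmax rho W V * norm2 x * opnorm (V k - W k))).
  apply: ler_sum => k _.
  apply: (le_trans (hybrid_perturb _ _ _ _ _ lip sigma0)).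
  rewrite ler_wpM2r ?opnorm_ge0// ler_wpM2r ?norm2_ge0//.
  exact: (le_bigmax 0 (fun k : 'I_H => Lconst rho (hybrid W V k.+1) H k) k).
have -> : Lmax rho W V * Num.sqrt H%:R * norm2 x * weights_dist V W
    = Lmax rho W V * norm2 x * (Num.sqrt H%:R * weights_dist V W).
  by ring.
rewrite -mulr_sumr ler_wpM2l ?sum_opnorm_le_weights_dist//.
by rewrite mulr_ge0 ?norm2_ge0// /Lmax bigmax_ge_id.
Qed.
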